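(* Let $N\ge2$ and let $F$ be any marginal distribution as in the context. Define, for $r\in(0,1]$, $$L(r)=\int_{[0,r]}\frac{x^{\frac N{N-1}}}{r^{\frac1{N-1}}}\,dF(x)+r(1-F(r)),$$ and let $r^*$ be a maximizer of $L$ over $(0,1]$. Then the revenue guarantee of the second price auction with random reserve distributed according to $G_{r^*}(x)=(x/r^* )^{\frac1{N-1}}$, $x\in[0,r^*]$, is strictly greater than the revenue guarantee of the second price auction with the optimal deterministic reserve price (the deterministic reserve price maximizing the revenue guarantee of the second price auction). That is, the former robustly dominates the latter.
   Context: A single indivisible good is sold to $N$ bidders with private values $v_i\in[0,1]$, each with the same marginal cdf $F$ whose support is $[0,1]$ (point masses allowed). $\Pi(F)$ is the set of probability measures on $[0,1]^N$ with all one-dimensional marginals equal to $F$. For a mechanism $(q,t)$ used with truthful bidding, its revenue guarantee is $\inf_{\pi\in\Pi(F)}\int\sum_it_i\,d\pi$. The second price auction with random reserve distributed as a cdf $G$: a reserve $\rho\sim G$ is drawn independently; a highest bidder (ties broken uniformly at random) wins if her bid is at least $\rho$ and pays $\max(\rho,\text{second highest bid})$. The second price auction with deterministic reserve $r$ is the case where $G$ is a point mass at $r$. A mechanism $M_1$ robustly dominates $M_2$ if the revenue guarantee of $M_1$ is strictly greater than that of $M_2$ for every marginal distribution. *)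

(* Defs.v *)
From HB Require Import structures.
From mathcomp Require Import all_boot all_order all_algebra.
From mathcomp Require Import all_classical all_reals all_analysis.

Import Order.TTheory GRing.Theory Num.Theory.
Local Open Scope classical_set_scope.
Local Open Scope ring_scope.

Section auction.
Variable R : realType.

Definition cdf (mu : set R -> \bar R) (x : R) : R := fine (mu [set` `]-oo, x]]).

Definition support01 (mu : set R -> \bar R) : Prop :=
  mu [set` `[0%R, 1%R]] = 1%E /\
  forall x : R, 0 <= x <= 1 -> forall e : R, 0 < e -> (0 < mu [set` `](x - e)%R, (x + e)%R[])%E.

Definition couplings (N : nat) (mu : set R -> \bar R)
  : set (probability (N.-tuple R) R) :=
  [set pi | forall (i : 'I_N) (A : set R), measurable A ->
              pi ((fun v : N.-tuple R => tnth v i) @^-1` A) = mu A].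

Definition bid1 (N : nat) (v : N.-tuple R) : R :=
  \big[Num.max/0]_(i < N) tnth v i.

(* second highest bid (with multiplicity): max over pairs i <> j of min *)
Definition bid2 (N : nat) (v : N.-tuple R) : R :=
  \big[Num.max/0]_(i < N) \big[Num.max/0]_(j < N | j != i)
     Num.min (tnth v i) (tnth v j).

(* total payment in the second price auction with random reserve rho ~ G
   (expectation over rho; tie-breaking does not affect the total payment):
   the winner pays max(rho, second bid) if the highest bid is >= rho *)
Definition spa_revenue (N : nat) (G : {measure set R -> \bar R})
  (v : N.-tuple R) : \bar R :=
  \int[G]_rho (if rho <= bid1 N v then Num.max rho (bid2 N v) else 0)%:E.

Definition revenue_guarantee (N : nat) (mu : set R -> \bar R)
  (G : {measure set R -> \bar R}) : \bar R :=
  ereal_inf [set (\int[pi]_v spa_revenue N G v)%E | pi in couplings N mu].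

Definition Lrevenue (N : nat) (mu : {measure set R -> \bar R}) (r : R) : \bar R :=
  (\int[mu]_(x in [set` `[0%R, r]]) (x `^ (N%:R / (N%:R - 1)) / r `^ (1 / (N%:R - 1)))%:E
   + (r * (1 - cdf mu r))%:E)%E.

Definition Gcdf (N : nat) (r x : R) : R :=
  if x < 0 then 0 else if x <= r then (x / r) `^ (1 / (N%:R - 1)) else 1.

End auction.

Arguments cdf {R}.
Arguments support01 {R}.
Arguments couplings {R}.
Arguments bid1 {R}.
Arguments bid2 {R}.
Arguments spa_revenue {R}.
Arguments revenue_guarantee {R}.
Arguments Lrevenue {R}.
Arguments Gcdf {R}.

(* Main.v *)
Require Import Defs.
From HB Require Import structures.
From mathcomp Require Import all_boot all_order all_algebra.
From mathcomp Require Import all_classical all_reals all_analysis.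
From mathcomp Require Import measurable_realfun ring lra.
Import Order.TTheory GRing.Theory Num.Theory.
Local Open Scope classical_set_scope.
Local Open Scope ring_scope.

(* Write G for the cdf of the random reserve and [m = N - 1], so that the bid [x] truncated
   to [0, r] is [r * G x ^ m]; put [shade x = r * G x ^ N], whence [L r] is the integral
   of [shade] against F.  With bids [b1 >= b2] on top, the random reserve earns
   [(shade b1 + m * shade b2) / N], at least the average of [shade] over the bidders, so its
   guarantee is at least [L r].

   For a deterministic reserve [p >= 0], let [s] be a quantile such that a fraction [1/N] of the
   mass of F on [p, +oo[ lies above [s].  Consider the following coupling: values below [p]
   occur only on the diagonal; otherwise one uniformly chosen bidder is above [s] and all
   others share a common value in [p, s].  There the revenue is exactly the average over the
   bidders of a function [dual_price], which on [p, s] is the tangent at [s] of the convex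
   function [shade], and which is [0] below [p].  Hence the guarantee of [p] is at most the
   integral of [dual_price], which is strictly less than [L s <= L r*]. *)

(** * Inequalities between powers and a lower Riemann sum *)

(** With [y = w ^+ m.+1] and [N = m.+2], this compares the convex function [y] to the power
    [N / (N - 1)] with its tangent at [y = 1], cleared of denominators. *)
Lemma pow_tangent_lt (R : realDomainType) (m : nat) (w : R) :
  0 <= w < 1 -> m.+2%:R * w ^+ m.+1 - 1 < m.+1%:R * w ^+ m.+2.
Proof.
move=> /andP[w0 w1].
elim: m => [|m IH].
  rewrite expr1 mul1r -subr_gt0 (_ : _ - _ = (1 - w) ^+ 2); last by ring.
  by rewrite exprn_gt0// subr_gt0.
have wm : w ^+ m.+2 < 1 by rewrite exprn_ilt1.
rewrite -subr_gt0.
(* The gap for the next exponent is [w] times the previous gap plus a product of two positive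
   factors. *)
rewrite (_ : _ - _ = w * (m.+1%:R * w ^+ m.+2 - (m.+2%:R * w ^+ m.+1 - 1))
   + (1 - w) * (1 - w ^+ m.+2)); last first.
  by rewrite -[m.+3]addn1 -[m.+2]addn1 -[m.+1]addn1 !natrD !exprD; ring.
by rewrite ltr_wpDl ?mulr_ge0 ?mulr_gt0 ?subr_gt0 ?subr_ge0// ltW// .
Qed.

Lemma pow_tangent_le (R : realDomainType) (m : nat) (w : R) :
  0 <= w <= 1 -> m.+2%:R * w ^+ m.+1 - 1 <= m.+1%:R * w ^+ m.+2.
Proof.
move=> /andP[w0]; rewrite le_eqVlt => /predU1P[->|w1]; last first.
  by apply: ltW; apply: pow_tangent_lt; rewrite w0.
by rewrite !expr1n !mulr1 -[m.+2]addn1 natrD addrK.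
Qed.

(** The difference factors as [b - a] times a sum of [m.+1] monomials of degree [m], each at most
    [b ^+ m]. *)
Lemma subrX_le (R : realDomainType) (m : nat) (a b : R) : 0 <= a <= b ->
  b ^+ m.+1 - a ^+ m.+1 <= m.+1%:R * b ^+ m * (b - a).
Proof.
move=> /andP[a0 ab]; rewrite subrXX mulrC ler_wpM2r ?subr_ge0//.
rewrite -[m.+1 in leRHS]card_ord mulr_natl -sumr_const; apply: ler_sum => i _.
have b0 : 0 <= b by apply: le_trans ab.
have im : (i <= m)%N by rewrite -ltnS.
rewrite /= -[X in _ <= b ^+ X](subnK im) exprD ler_wpM2l ?exprn_ge0//.
by rewrite lerXn2r.
Qed.

(* On a subdivision of [a, b] into [n.+1] equal pieces the error is at most
   [(b - a) * (b ^+ m - a ^+ m) / n.+1]. *)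
Lemma pow_lower_sum (R : archiRealFieldType) (m : nat) (D : R -> R) (a b : R) :
  0 <= a <= b ->
  (forall x y, a <= x <= y -> y <= b -> x ^+ m * (y - x) <= D y - D x) ->
  (b ^+ m.+1 - a ^+ m.+1) / m.+1%:R <= D b - D a.
Proof.
move=> /andP[a0 ab] HD.
have key (n : nat) : (b ^+ m.+1 - a ^+ m.+1) / m.+1%:R <=
    D b - D a + (b - a) * (b ^+ m - a ^+ m) / n.+1%:R.
  set d := (b - a) / n.+1%:R.
  have d0 : 0 <= d by rewrite divr_ge0 ?subr_ge0.
  pose x k := a + k%:R * d.
  have xS k : x k.+1 = x k + d by rewrite /x -natr1; ring.
  have dx k : x k.+1 - x k = d by rewrite xS addrAC subrr add0r.
  have x0 : x 0 = a by rewrite /x mul0r addr0.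
  have xn : x n.+1 = b by rewrite /x /d mulrC divfK ?pnatr_eq0//; ring.
  have ax k : a <= x k by rewrite /x lerDl mulr_ge0.
  have xb k : (k <= n.+1)%N -> x k <= b.
    by move=> kn; rewrite -xn /x lerD2l ler_wpM2r// ler_nat.
  (* On each piece the left side grows by at most [d] times the right end value of the power, and
     [D] by at least [d] times the left end value; the discrepancies telescope. *)
  have step k : (k <= n.+1)%N -> (x k ^+ m.+1 - a ^+ m.+1) / m.+1%:R <=
      D (x k) - D a + d * (x k ^+ m - a ^+ m).
    elim: k => [_|k IH kn]; first by rewrite x0 !subrr mul0r mulr0 addr0.
    have kn' := ltnW kn.
    have := IH kn'.
    have xk : x k <= x k.+1 by rewrite -subr_ge0 dx.
    have := HD (x k) (x k.+1).
    rewrite ax xk xb// dx => /(_ isT isT).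
    have : (x k.+1 ^+ m.+1 - x k ^+ m.+1) / m.+1%:R <= d * x k.+1 ^+ m.
      rewrite ler_pdivrMr//.
      have := @subrX_le _ m (x k) (x k.+1).
      rewrite (le_trans a0 (ax k)) xk dx => /(_ isT) /le_trans; apply.
      by rewrite -mulrA mulrC (mulrC d).
    set A := x k.+1 ^+ m.+1; set B := x k ^+ m.+1.
    rewrite !mulrBl !mulrBr (mulrC _ d).
    set i := m.+1%:R^-1; set u := A * i; set v := B * i; set t := _ * i.
    set X := d * _; set Y := d * _; set Z := d * _.
    lra.
  by move: (step n.+1 (leqnn _)); rewrite xn /d mulrAC.
rewrite leNgt; apply/negP => lt.
set e := (b ^+ m.+1 - a ^+ m.+1) / m.+1%:R - (D b - D a).
have e0 : 0 < e by rewrite subr_gt0.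
set c := (b - a) * (b ^+ m - a ^+ m).
have c0 : 0 <= c by rewrite mulr_ge0 ?subr_ge0// lerXn2r// nnegrE (le_trans a0 ab).
(* For this index [n.+1] exceeds [c / e], so the error term drops below the supposed gap [e]. *)
have := key (Num.truncn (c / e)).
rewrite -lerBlDl -/e -/c; apply/negP; rewrite -ltNge.
rewrite ltr_pdivrMr// -ltr_pdivrMl// mulrC.
by rewrite truncnS_gt.
Qed.

(** * The distribution function of the random reserve *)

Section reserve_cdf.
Variables (R : realType) (m : nat).
Local Notation N := m.+2.
Implicit Types (r x y w : R).

Lemma NsubnE : N%:R - 1 = m.+1%:R :> R.
Proof. by rewrite -natr1 addrK. Qed.

Lemma Gcdf_itv01 r x : 0 < r -> 0 <= Gcdf N r x <= 1.
Proof.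
move=> r0; rewrite /Gcdf; case: (ltP x 0) => [_|x0]; first by rewrite lexx ler01.
case: (leP x r) => [xr|_]; last by rewrite ler01 lexx.
rewrite powR_ge0/= [leRHS](_ : 1 = 1 `^ (1 / (N%:R - 1))); last by rewrite powR1.
apply: ge0_ler_powR; rewrite ?nnegrE ?NsubnE ?ler_pdivrMr ?mul1r ?divr_ge0 ?ler01 ?ler0n//; exact: ltW.
Qed.

(** Raising to the power [m.+1] removes the real exponent [1 / (N - 1)]; later steps mostly use
    natural powers of [w = Gcdf N r x]. *)
Lemma Gcdf_pow r x : 0 < r -> r * Gcdf N r x ^+ m.+1 = Num.max 0 (Num.min x r).
Proof.
move=> r0; rewrite /Gcdf; case: (ltP x 0) => [x0|x0].
  by rewrite expr0n mulr0 min_l ?max_l ?ltW// (lt_trans x0).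
case: (leP x r) => [xr|xr]; last by rewrite expr1n mulr1 max_r ?ltW.
rewrite -powR_mulrn ?powR_ge0// -powRrM NsubnE mul1r mulVf ?pnatr_eq0//.
rewrite powRr1 ?divr_ge0// ?ltW// mulrC divfK ?gt_eqF//.
by rewrite max_r.
Qed.

(** Thus [r * w ^+ m.+1] is the quantile of the reserve at level [w]. *)
Lemma Gcdf_powK r w : 0 < r -> 0 <= w <= 1 -> Gcdf N r (r * w ^+ m.+1) = w.
Proof.
move=> r0 /andP[w0 w1].
have a0 : 0 <= r * w ^+ m.+1 by rewrite mulr_ge0 ?exprn_ge0 ?(ltW r0).
have ar : r * w ^+ m.+1 <= r by rewrite ler_piMr ?(ltW r0) ?exprn_ile1.
have /andP[G0 G1] := Gcdf_itv01 _ (r * w ^+ m.+1) r0.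
apply: (@pexpIrn _ m.+1) => //.
apply: (@mulfI _ r); first by rewrite gt_eqF.
by rewrite Gcdf_pow// min_l// max_r.
Qed.

Lemma Gcdf_homo r : 0 < r -> {homo Gcdf N r : x y / x <= y}.
Proof.
move=> r0 x y xy.
have /andP[Gx0 _] := Gcdf_itv01 _ x r0.
have /andP[Gy0 _] := Gcdf_itv01 _ y r0.
rewrite -(@ler_pXn2r _ m.+1)// ?nnegrE// -(ler_pM2l r0) !Gcdf_pow//.
by rewrite ge_max !le_max lexx/= le_min !ge_min xy lexx !orbT.
Qed.

End reserve_cdf.

(** * Integrals against the law of the reserve *)

Section random_reserve.
Variables (R : realType) (m : nat) (r : R) (r0 : 0 < r).
Local Notation N := m.+2.
Variable G : probability R R.
Hypothesis hG : forall x : R, G [set` `]-oo, x]] = (Gcdf N r x)%:E.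
Local Open Scope ereal_scope.

(** In the quantile coordinate the reserve is uniform on [[0, 1]]. *)
Lemma Gcdf_itv_oc (a b : R) : (0 <= a <= b)%R -> (b <= 1)%R ->
  G [set` `](r * a ^+ m.+1)%R, (r * b ^+ m.+1)%R]] = (b - a)%:E.
Proof.
move=> /andP[a0 ab] b1.
have b0 := le_trans a0 ab.
have ra : Gcdf N r (r * a ^+ m.+1) = a by rewrite Gcdf_powK// a0 (le_trans ab).
have rb : Gcdf N r (r * b ^+ m.+1) = b by rewrite Gcdf_powK// b0.
have : G [set` `]-oo, (r * b ^+ m.+1)%R]] =
    G [set` `]-oo, (r * a ^+ m.+1)%R]] + G [set` `](r * a ^+ m.+1)%R, (r * b ^+ m.+1)%R]].
  rewrite -measureU//=.
    rewrite -itv_bndbnd_setU// bnd_simp.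
    by rewrite ler_pM2l// lerXn2r.
  apply/seteqP; split=> x //=; rewrite !in_itv/= => -[h /andP[h' _]].
  by move: (le_lt_trans h h'); rewrite ltxx.
rewrite !hG ra rb; set g := G [set` `]_, _]].
have gf : g \is a fin_num by exact: fin_num_measure.
by rewrite -(fineK gf) -EFinD => -[->]; rewrite addrAC subrr add0r.
Qed.

(** Substituting [x = r * w ^+ m.+1] turns the right side into the integral of [r * w ^+ m.+1] over
    [[a, b]]; [pow_lower_sum] gives the lower bound without a change of variables. *)
Lemma integral_reserve_ge (a b : R) : (0 <= a <= b)%R -> (b <= 1)%R ->
  (r * ((b ^+ N - a ^+ N) / N%:R))%:E <=
  \int[G]_(x in [set` `](r * a ^+ m.+1)%R, (r * b ^+ m.+1)%R]]) x%:E.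
Proof.
move=> /andP[a0 ab] b1.
pose p (x : R) := (r * x ^+ m.+1)%R.
have p0 (x : R) : (0 <= x)%R -> (0 <= p x)%R by move=> x0; rewrite mulr_ge0 ?exprn_ge0// ltW.
have ple (x y : R) : (0 <= x <= y)%R -> (p x <= p y)%R.
  by move=> /andP[x0 xy]; rewrite ler_pM2l// lerXn2r// nnegrE (le_trans x0).
pose J x y := \int[G]_(x in [set` `](p x), (p y)]]) x%:E.
have mid (D : set R) : measurable_fun D (@EFin R).
  exact: measurable_funTS.
have ge x y t : (0 <= x)%R -> [set` `](p x), (p y)]] t -> 0 <= t%:E.
  by move=> x0; rewrite /= in_itv/= lee_fin => /andP[/ltW /(le_trans (p0 _ x0))].
have J0 x y : (0 <= x)%R -> 0 <= J x y.
  by move=> x0; apply: integral_ge0 => t; exact: ge.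
have JD x y z : (0 <= x <= y)%R -> (y <= z)%R -> J x z = J x y + J y z.
  move=> /andP[x0 xy] yz; have y0 := le_trans x0 xy.
  rewrite /J -ge0_integral_setU//=.
  - by rewrite -itv_bndbnd_setU// bnd_simp ple// ?x0 ?y0.
  - by move=> t []; apply: ge.
  - rewrite disj_set2E; apply/eqP/seteqP; split=> t //=.
    rewrite !in_itv/= => -[/andP[_ h] /andP[h' _]].
    by move: (le_lt_trans h h'); rewrite ltxx.
have Jfin x y : (0 <= x <= y)%R -> (y <= 1)%R -> J x y \is a fin_num.
  move=> /andP[x0 xy] y1; rewrite ge0_fin_numE ?J0//.
  apply: (@le_lt_trans _ _ (\int[G]_(x in [set` `](p x), (p y)]]) (p y)%:E)).
    apply: ge0_le_integral => //; first by move=> t; exact: ge.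
    by move=> t /=; rewrite in_itv/= lee_fin => /andP[].
  by rewrite integral_cst// lte_mul_pinfty ?lee_fin ?p0 ?(le_trans x0)// ltey_eq fin_num_measure.
(* On this piece the integrand is at least its left end [p x], and the mass is [y - x]. *)
have Jge x y : (0 <= x <= y)%R -> (y <= 1)%R -> (p x * (y - x))%:E <= J x y.
  move=> xy y1; rewrite EFinM -(Gcdf_itv_oc _ _ xy y1) -integral_cst//.
  case/andP: xy => x0 xy.
  apply: ge0_le_integral => //.
  - by move=> t _; rewrite lee_fin p0.
  - by move=> t /=; rewrite in_itv/= lee_fin => /andP[/ltW].
have fJD x y z : (0 <= x <= y)%R -> (y <= z)%R -> (z <= 1)%R ->
    (fine (J x z) - fine (J x y) = fine (J y z))%R.
  move=> xy yz z1; rewrite (JD x y z)// fineD ?Jfin//.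
  - by rewrite addrC addKr.
  - exact: le_trans z1.
  - by rewrite yz andbT; case/andP: xy => x0; exact: le_trans.
rewrite -[leRHS](@fineK _ (J a b)) ?Jfin ?a0// lee_fin mulrC -ler_pdivlMr//.
have Jaa : fine (J a a) = 0%R.
  by have := fJD a a b; rewrite a0 ab lexx => /(_ isT isT b1); lra.
(* The function [D] is the partial integral from [a], divided by [r]; its increments are bounded
   below by [Jge]. *)
have := @pow_lower_sum R m.+1 (fun x => fine (J a x) / r)%R a b.
rewrite Jaa mul0r subr0; apply; rewrite ?a0// => x y /andP[ax xy] yb.
have x0 := le_trans a0 ax; have y1 := le_trans yb b1.
rewrite -mulrBl fJD ?a0// ler_pdivlMr//.
rewrite -lee_fin fineK ?Jfin ?x0//.
by apply: le_trans (Jge _ _ _ y1); rewrite ?x0// lee_fin /p mulrC mulrA.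
Qed.

End random_reserve.

(** * Integrability and measurability tools *)

Lemma probability_bounded_integrable d (T : measurableType d) (R : realType)
    (P : probability T R) (f : T -> R) (M : R) :
  measurable_fun setT f -> (forall x, `|f x| <= M) ->
  P.-integrable setT (EFin \o f).
Proof.
move=> mf fM; apply: measurable_bounded_integrable => //.
  by rewrite ltey_eq fin_num_measure.
exists M; split; rewrite ?num_real// => y My x _.
by apply: le_trans (fM _) _; exact: ltW.
Qed.

Lemma measurable_bigmax d (T : measurableType d) (R : realType) (I : Type)
    (s : seq I) (P : pred I) (x0 : R) (F : T -> I -> R) :
  (forall i, measurable_fun setT (F ^~ i)) ->
  measurable_fun setT (fun t => \big[Num.max/x0]_(i <- s | P i) F t i).
Proof.
move=> mF; elim: s => [|i s IH].
  rewrite (_ : (fun t => _) = cst x0)//.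
  by apply/funext => t; rewrite big_nil.
rewrite (_ : (fun t => _) = fun t => if P i
    then Num.max (F t i) (\big[Num.max/x0]_(i <- s | P i) F t i)
    else \big[Num.max/x0]_(i <- s | P i) F t i); last first.
  by apply/funext => t; rewrite big_cons.
by case: (P i) => //; exact: measurable_maxr.
Qed.

(** * The two highest bids, the payment, and integration under a coupling *)

Section bids.
Variables (R : realType) (N : nat).
Implicit Types (v : N.-tuple R) (i j : 'I_N).

Lemma bid1_ge0 v : 0 <= bid1 N v.
Proof. exact: bigmax_ge_id. Qed.

Lemma bid2_ge0 v : 0 <= bid2 N v.
Proof. exact: bigmax_ge_id. Qed.

Lemma tnth_le_bid1 v i : tnth v i <= bid1 N v.
Proof. exact: (le_bigmax_cond _ (fun i => tnth v i)). Qed.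

Lemma min_le_bid2 v i j : j != i -> Num.min (tnth v i) (tnth v j) <= bid2 N v.
Proof.
move=> ji; apply: le_trans (le_bigmax_cond _ _ (isT : xpredT i)).
exact: (le_bigmax_cond _ (fun j => Num.min (tnth v i) (tnth v j))).
Qed.

Lemma bid2_le_bid1 v : bid2 N v <= bid1 N v.
Proof.
apply/bigmax_leP; split; first exact: bid1_ge0.
move=> i _; apply/bigmax_leP; split; first exact: bid1_ge0.
by move=> j _; rewrite ge_min tnth_le_bid1.
Qed.

(** The exception is a bidder of maximal bid: paired with it, any other bid is the minimum of the
    pair. *)
Lemma all_but_one_le_bid2 v : (0 < N)%N ->
  exists i, forall j, j != i -> tnth v j <= bid2 N v.
Proof.
move=> N0.
case: (@Order.TotalTheory.arg_maxP _ _ 'I_N (Ordinal N0) xpredT (tnth v) isT).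
move=> i _ imax; exists i => j ji.
rewrite (le_trans _ (min_le_bid2 v _ _ ji))// le_min lexx andbT.
exact: imax.
Qed.

Lemma measurable_bid1 : measurable_fun setT (@bid1 R N).
Proof. by apply: measurable_bigmax => i; exact: measurable_tnth. Qed.

Lemma measurable_bid2 : measurable_fun setT (@bid2 R N).
Proof.
apply: measurable_bigmax => i; apply: measurable_bigmax => j.
by apply: measurable_minr; exact: measurable_tnth.
Qed.

Local Open Scope ereal_scope.

Lemma measurable_payment :
  measurable_fun setT (fun vp : N.-tuple R * R =>
    (if (vp.2 <= bid1 N vp.1)%R then Num.max vp.2 (bid2 N vp.1) else 0%R)%:E).
Proof.
apply/measurable_EFinP; apply: measurable_fun_ifT => //.
- apply: measurable_fun_ler => //.
  exact: (measurableT_comp measurable_bid1).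
- by apply: measurable_maxr => //; exact: (measurableT_comp measurable_bid2).
Qed.

Lemma payment_ge0 v rho :
  0 <= (if (rho <= bid1 N v)%R then Num.max rho (bid2 N v) else 0%R)%:E.
Proof. by case: ifP => _; rewrite lee_fin// le_max bid2_ge0 orbT. Qed.

Lemma measurable_spa_revenue (G : probability R R) :
  measurable_fun setT (spa_revenue N G).
Proof.
apply: (measurable_fun_fubini_tonelli_F _ measurable_payment).
by move=> vp; exact: payment_ge0.
Qed.

Lemma measurable_payment2 v :
  measurable_fun setT (fun rho : R =>
    (if (rho <= bid1 N v)%R then Num.max rho (bid2 N v) else 0%R)%:E).
Proof.
apply/measurable_EFinP; apply: measurable_fun_ifT => //.
- exact: measurable_fun_ler.
- exact: measurable_maxr.
Qed.

Lemma spa_revenue_dirac (r : R) v : spa_revenue N (\d_r) v =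
  (if (r <= bid1 N v)%R then Num.max r (bid2 N v) else 0%R)%:E.
Proof.
rewrite /spa_revenue integral_dirac//; last exact: measurable_payment2.
by rewrite diracT mul1e.
Qed.

(** Every coordinate has law [mu], so the mean of a separable function is the same under all
    couplings. Separable bounds on revenue thereby become bounds on the guarantee. *)
Lemma coupling_integral (mu : probability R R) pi (phi : R -> R) (M : R) :
  (0 < N)%N -> couplings N mu pi -> measurable_fun setT phi ->
  (forall x, `|phi x| <= M)%R ->
  \int[pi]_v (N%:R^-1 * \sum_(i < N) phi (tnth v i))%:E = \int[mu]_x (phi x)%:E.
Proof.
move=> N0 cpi mphi phiM.
have imu : mu.-integrable setT (EFin \o phi) by exact: probability_bounded_integrable phiM.
have mi i : measurable_fun setT (fun v : N.-tuple R => phi (tnth v i)).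
  by apply: measurableT_comp => //; exact: measurable_tnth.
have ipi i : pi.-integrable setT (fun v : N.-tuple R => (phi (tnth v i))%:E).
  exact: (@probability_bounded_integrable _ _ _ _ (fun v : N.-tuple R => phi (tnth v i)) M).
under eq_integral do rewrite EFinM -sumEFin.
rewrite integralZl//; last exact: integrable_sum.
rewrite integral_sum//.
rewrite (eq_bigr (fun=> \int[mu]_x (phi x)%:E)); last first.
  move=> i _.
  have := @integral_pushforward _ _ _ _ R _ (@measurable_tnth _ R N i) pi setT (EFin \o phi).
  move=> /(_ _ (ipi i) measurableT) <-; last exact/measurable_EFinP.
  apply: eq_measure_integral; first exact: measurable_tnth.
  by move=> ? A mA _; exact: cpi.
have /fineK <- := integrable_fin_num measurableT imu.
rewrite sumEFin sumr_const card_ord -EFinM -[(fine _ *+ _)%R]mulr_natl mulKf//.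
by rewrite pnatr_eq0 -lt0n.
Qed.

End bids.

(** * The function [shade] and its mean [L] *)

Section shade.
Variables (R : realType) (m : nat) (r : R).
Hypothesis r0 : 0 < r.
Local Notation N := m.+2.

(** On [[0, s]] this is the integrand of [Lrevenue]; above [s] it is the constant [s], which
    accounts for the tail term of [Lrevenue]. *)
Definition shade (n : nat) (s x : R) : R := s * Gcdf n s x ^+ n.

Lemma shade_ge0 x : 0 <= shade N r x.
Proof. by have /andP[? _] := Gcdf_itv01 R m r x r0; rewrite mulr_ge0 ?exprn_ge0// ltW. Qed.

Lemma shade_le x : shade N r x <= r.
Proof.
have /andP[? ?] := Gcdf_itv01 R m r x r0.
by rewrite ler_piMr ?exprn_ile1// ltW.
Qed.

Lemma normr_shade_le x : `|shade N r x| <= r.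
Proof. by rewrite ger0_norm ?shade_ge0// shade_le. Qed.

Lemma shade_homo : {homo shade N r : x y / x <= y}.
Proof.
move=> x y xy; have /andP[Gx _] := Gcdf_itv01 R m r x r0.
rewrite ler_pM2l// lerXn2r//; last exact: Gcdf_homo.
by rewrite nnegrE (le_trans Gx)//; exact: Gcdf_homo.
Qed.

Lemma measurable_shade : measurable_fun setT (shade N r).
Proof. exact: nondecreasing_measurable shade_homo. Qed.

Lemma shade_itv x : 0 <= x <= r ->
  shade N r x = x `^ (N%:R / (N%:R - 1)) / r `^ (1 / (N%:R - 1)).
Proof.
move=> /andP[x0 xr].
(* One factor [Gcdf N r x] is split off; the other [m.+1] factors, together with [r], make up
   [x]. *)
rewrite /shade exprS mulrCA Gcdf_pow// min_l// max_r// /Gcdf ltNge x0/= xr.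
rewrite powRM ?invr_ge0 ?(ltW r0)// -[r^-1](powR_inv1 (ltW r0)) powRAC powR_inv1 ?powR_ge0//.
rewrite mulrAC -[X in _ * X / _](powRr1 x0) -powRD; last first.
  by rewrite NsubnE gt_eqF// addr_gt0// divr_gt0.
have : m.+1%:R != 0 :> R by rewrite pnatr_eq0.
rewrite NsubnE -(natr1 m.+1); move: m.+1%:R => c c0.
by congr (_ `^ _ / _); field.
Qed.

Lemma shade_gt x : r < x -> shade N r x = r.
Proof.
move=> rx; rewrite /shade /Gcdf ltNge (ltW (lt_trans r0 rx))/= leNgt rx/=.
by rewrite expr1n mulr1.
Qed.

Lemma shade_lt0 x : x < 0 -> shade N r x = 0.
Proof. by move=> x0; rewrite /shade /Gcdf x0 expr0n mulr0. Qed.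

Local Open Scope ereal_scope.

(** The line is cut at [0] and [r]: [shade] vanishes to the left, is the integrand of [Lrevenue] in
    between, and is [r] to the right. *)
Lemma LrevenueE (mu : probability R R) :
  Lrevenue N mu r = \int[mu]_x (shade N r x)%:E.
Proof.
have mS (D : set R) : measurable_fun D (EFin \o shade N r).
  by apply/measurable_funTS/measurable_EFinP; exact: measurable_shade.
have T1 : [set: R] = [set` `]-oo, r]] `|` [set` `]r, +oo[] by rewrite -itv_bndbnd_setU// set_itvE.
have T2 : [set` `]-oo, r]] = [set` `]-oo, 0%R[] `|` [set` `[0%R, r]].
  by rewrite -itv_bndbnd_setU// bnd_simp ltW.
rewrite T1 ge0_integral_setU//=; first last.
- rewrite disj_set2E; apply/eqP/seteqP; split=> x //=.
  by rewrite !in_itv/= andbT => -[xr]; rewrite ltNge xr.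
- by move=> x _; rewrite lee_fin shade_ge0.
rewrite T2 ge0_integral_setU//=; first last.
- rewrite disj_set2E; apply/eqP/seteqP; split=> x //=.
  by rewrite !in_itv/= => -[x0 /andP[]]; rewrite leNgt x0.
- by move=> x _; rewrite lee_fin shade_ge0.
rewrite integral0_eq ?add0e; last first.
  by move=> x /=; rewrite in_itv/= => x0; rewrite shade_lt0.
rewrite /Lrevenue; congr (_ + _).
  by apply: eq_integral => x; rewrite inE/= in_itv/= => xr; rewrite shade_itv.
under eq_integral => x do rewrite inE/= in_itv/= andbT => /shade_gt ->.
rewrite integral_cst//= EFinM; congr (_ * _).
rewrite /cdf EFinB fineK ?fin_num_measure//.
have := @probability_setC _ _ _ mu [set` `]-oo, r]].
by rewrite setCitvl => ->.
Qed.

End shade.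

(** * Lower bound on the guarantee of the random reserve *)

Section random_reserve_guarantee.
Variables (R : realType) (m : nat) (r : R).
Hypothesis r0 : 0 < r.
Local Notation N := m.+2.
Variable G : probability R R.
Hypothesis hG : forall x : R, G [set` `]-oo, x]] = (Gcdf N r x)%:E.
Local Open Scope ereal_scope.

(** Reserves up to the clamped second bid [c2] have probability [w2] and earn at least [c2];
    reserves in []c2, c1]] earn at least themselves. The total is [r * w2 ^+ N + r * (w1 ^+ N - w2
    ^+ N) / N]. *)
Lemma spa_revenue_ge_top2 (v : N.-tuple R) :
  ((shade R N r (bid1 N v) + m.+1%:R * shade R N r (bid2 N v)) / N%:R)%:E
    <= spa_revenue N G v.
Proof.
set b1 := bid1 N v; set b2 := bid2 N v.
have b20 : (0 <= b2)%R := bid2_ge0 _ _ v.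
have b21 : (b2 <= b1)%R := bid2_le_bid1 _ _ v.
have [/andP[w10 w11] /andP[w20 w21]] := (Gcdf_itv01 R m r b1 r0, Gcdf_itv01 R m r b2 r0).
have w21' := Gcdf_homo R m r r0 _ _ b21.
have [e1 e2] := (Gcdf_pow R m r b1 r0, Gcdf_pow R m r b2 r0).
rewrite /shade; set w1 := Gcdf N r b1 in w10 w11 w21' e1 *.
set w2 := Gcdf N r b2 in w20 w21 w21' e2 *.
(* By [Gcdf_pow], [c1] and [c2] are the two bids clamped to [[0, r]]. *)
set c1 := (r * w1 ^+ m.+1)%R in e1; set c2 := (r * w2 ^+ m.+1)%R in e2.
have c1b : (c1 <= b1)%R by rewrite e1 ge_max (le_trans b20)//= ge_min lexx.
have c2b : (c2 <= b2)%R by rewrite e2 ge_max b20/= ge_min lexx.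
have c20 : (0 <= c2)%R by rewrite e2 le_max lexx.
pose pay rho := (if (rho <= b1)%R then Num.max rho b2 else 0%R)%:E.
have mpay (D : set R) : measurable_fun D pay.
  exact: measurable_funTS (measurable_payment2 R N v).
have mid (D : set R) : measurable_fun D (@EFin R) by exact: measurable_funTS.
have pay0 rho : 0 <= pay rho by exact: payment_ge0.
rewrite /spa_revenue -/pay.
apply: (@le_trans _ _ (\int[G]_(x in [set` `]-oo, c2]] `|` [set` `]c2, c1]]) pay x)); last first.
  apply: ge0_subset_integral => //. exact: measurableU.
rewrite ge0_integral_setU//=; last first.
  rewrite disj_set2E; apply/eqP/seteqP; split=> x //=.
  by rewrite !in_itv/= => -[h /andP[h' _]]; move: (le_lt_trans h h'); rewrite ltxx.
have lo : (c2 * w2)%:E <= \int[G]_(x in [set` `]-oo, c2]]) pay x.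
  have <- : \int[G]_(x in [set` `]-oo, c2]]) (cst c2%:E x) = (c2 * w2)%:E.
    rewrite integral_cst// (EFinM c2 w2); congr (_ * _).
    by apply: etrans (hG c2) _; rewrite /c2 Gcdf_powK ?w20.
  apply: ge0_le_integral => // x.
  rewrite /= in_itv/= => xc; rewrite /pay ifT ?lee_fin ?le_max ?c2b ?orbT//.
  by rewrite (le_trans xc)// (le_trans c2b).
have hi : (r * ((w1 ^+ N - w2 ^+ N) / N%:R))%:E <= \int[G]_(x in [set` `]c2, c1]]) pay x.
  apply: le_trans (integral_reserve_ge R m r r0 G hG w2 w1 _ w11) _; first by rewrite w20.
  apply: ge0_le_integral => //.
  - by move=> x /=; rewrite in_itv/= lee_fin => /andP[/ltW /(le_trans c20)].
  - move=> x /=; rewrite in_itv/= => /andP[_ xc].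
    by rewrite /pay ifT ?lee_fin ?le_max ?lexx// (le_trans xc).
apply: le_trans (leeD lo hi); rewrite -EFinD lee_fin /c2 -mulrA -exprSr.
rewrite -(natr1 m.+1); have : (0 < m.+1%:R :> R)%R by [].
set u := (w1 ^+ N)%R; set t := (w2 ^+ N)%R; move: m.+1%:R => c cp.
rewrite le_eqVlt; apply/orP; left; apply/eqP; field.
by rewrite gt_eqF// ltr_wpDl// ltW.
Qed.

(** Since [shade] is monotone, one bidder contributes at most its value at the highest bid, and each
    of the other [m.+1] at most its value at the second. *)
Lemma spa_revenue_ge (v : N.-tuple R) :
  (N%:R^-1 * \sum_(i < N) shade R N r (tnth v i))%:E <= spa_revenue N G v.
Proof.
apply: le_trans (spa_revenue_ge_top2 v); rewrite lee_fin mulrC ler_pM2r ?invr_gt0//.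
have [i hi] := all_but_one_le_bid2 R N v isT.
rewrite (bigD1 i)//= lerD//; first by apply: shade_homo => //; exact: tnth_le_bid1.
have cardi : #|[pred j : 'I_N | j != i]| = m.+1.
  by have := cardC1 i; rewrite card_ord.
apply: (@le_trans _ _ (\sum_(j < N | j != i) shade R N r (bid2 N v))%R).
  by apply: ler_sum => j ji; apply: shade_homo => //; exact: hi.
by rewrite sumr_const cardi mulr_natl.
Qed.

Lemma revenue_guarantee_ge (mu : probability R R) :
  Lrevenue N mu r <= revenue_guarantee N mu G.
Proof.
rewrite LrevenueE//; apply: le_ereal_inf_tmp => _ [pi cpi <-].
have ms := measurable_shade R m r r0.
rewrite -(coupling_integral R N mu pi _ r isT cpi ms); last first.
  by move=> x; exact: normr_shade_le.
apply: ge0_le_integral => //.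
- move=> v _; rewrite lee_fin mulr_ge0// ?invr_ge0// sumr_ge0// => i _.
  exact: shade_ge0.
- apply/measurable_EFinP; apply: measurable_funM => //.
  apply: measurable_sum => i; apply: measurableT_comp => //; exact: measurable_tnth.
- exact: measurable_spa_revenue.
- by move=> v _; exact: spa_revenue_ge.
Qed.

End random_reserve_guarantee.

(** * Upper quantiles and sums of finite measures *)

Section measure_tools.
Local Open Scope ereal_scope.

(** The witness is the supremum of the points up to [M] whose closed upper ray has mass at least
    [a]; the cap [M] keeps this set bounded even for [a = 0]. The two bounds differ by the atom at
    [s]. *)
Lemma upper_quantile (R : realType) (mu : probability R R) (x0 M : R) (a : \bar R) :
  (x0 <= M)%R -> mu [set` `]M, +oo[] = 0 -> 0 <= a -> a <= mu [set` `[x0, +oo[] ->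
  exists s : R, [/\ (x0 <= s <= M)%R, mu [set` `]s, +oo[] <= a & a <= mu [set` `[s, +oo[]].
Proof.
move=> x0M muM a0 ax0.
pose S := [set x : R | (x <= M)%R /\ a <= mu [set` `[x, +oo[]].
have Sx0 : S x0 by [].
have SM : ubound S M by move=> x [].
have supS : has_sup S by split; [exists x0|exists M].
have x0s : (x0 <= sup S)%R by apply: ub_le_sup => //; exists M.
have sM : (sup S <= M)%R by apply: ge_sup => //; exists x0.
exists (sup S); split; first by rewrite x0s.
(* Continuity from below: each ray in the union starts beyond the supremum, hence has mass below
   [a], or starts beyond [M], hence has mass zero. *)
- rewrite itvoyEbigcup.
  pose F k := [set` `[(sup S + k.+1%:R^-1)%R, +oo[].
  have mF k : measurable (F k) by exact: measurable_itv.
  have cvgF : mu (F k) @[k --> \oo] --> mu (\bigcup_k F k).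
    apply: nondecreasing_cvg_mu => //; first by apply: bigcup_measurable => k _.
    move=> i j ij; apply/subsetPset; apply: subset_itvr.
    by rewrite bnd_simp lerD2l lef_pV2 ?posrE// ler_nat.
  rewrite -(cvg_lim _ cvgF)//; apply: lime_le; first by apply/cvg_ex; eexists; exact: cvgF.
  apply: nearW => k; rewrite /F.
  have [kM|kM] := leP (sup S + k.+1%:R^-1)%R M; last first.
    apply: le_trans a0; rewrite -muM; apply: le_measure; rewrite ?inE//.
    by apply: subset_itvr; rewrite bnd_simp.
  rewrite leNgt; apply/negP => /ltW h.
  have : (sup S + k.+1%:R^-1 <= sup S)%R by apply: ub_le_sup; [exists M|].
  by rewrite leNgt ltrDl invr_gt0 ltr0Sn.
(* Continuity from above: each ray in the intersection contains the closed ray of a member of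
   [S]. *)
- rewrite itvcyEbigcap.
  pose F k := [set` `](sup S - k.+1%:R^-1)%R, +oo[].
  have mF k : measurable (F k) by exact: measurable_itv.
  have cvgF : mu (F k) @[k --> \oo] --> mu (\bigcap_k F k).
    apply: nonincreasing_cvg_mu => //; first by rewrite ltey_eq fin_num_measure.
      by apply: bigcap_measurable => // k _.
    move=> i j ij; apply/subsetPset; apply: subset_itvr.
    by rewrite bnd_simp lerD2l lerN2 lef_pV2 ?posrE// ler_nat.
  rewrite -(cvg_lim _ cvgF)//; apply: lime_ge; first by apply/cvg_ex; eexists; exact: cvgF.
  apply: nearW => k.
  have k0 : (0 < k.+1%:R^-1 :> R)%R by rewrite invr_gt0.
  have [x [xM ax] kx] := sup_adherent k0 supS.
  apply: le_trans ax _; apply: le_measure; rewrite ?inE//.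
  by apply: subset_itvr; rewrite bnd_simp.
Qed.

Lemma finite_measure_add d (T : measurableType d) (R : realType)
    (m1 m2 : {finite_measure set T -> \bar R}) :
  exists m : {finite_measure set T -> \bar R}, forall A, m A = m1 A + m2 A.
Proof.
have fin : fin_num_fun (measure_add m1 m2).
  by move=> A mA; rewrite measure_addE fin_numD !fin_num_measure.
pose m : {measure set T -> \bar R} := measure_add m1 m2.
pose mf : {finite_measure set T -> \bar R} := HB.pack (Measure.sort m)
  (Measure.class m) (Measure_isFinite.Build _ _ _ (Measure.sort m) fin).
by exists mf => A; exact: measure_addE.
Qed.

End measure_tools.

(** * Couplings concentrated on diagonal and star-shaped profiles *)

Section star_coupling.
Variables (R : realType) (m : nat).
Local Notation N := m.+2.

Definition diag_tuple (y : R) : N.-tuple R := [tuple y | j < N].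

(** The index is a natural number so that the family of image measures can be summed by [msum]. *)
Definition star_tuple (i : nat) (xy : R * R) : N.-tuple R :=
  [tuple if j == i :> nat then xy.1 else xy.2 | j < N].

Lemma measurable_diag_tuple : measurable_fun setT diag_tuple.
Proof.
apply/measurable_fun_tnthP => j; rewrite (_ : _ \o _ = id)//.
by apply/funext => y /=; rewrite tnth_mktuple.
Qed.

Lemma measurable_star_tuple i : measurable_fun setT (star_tuple i).
Proof.
apply/measurable_fun_tnthP => j.
rewrite (_ : _ \o _ = if j == i :> nat then fst else snd); first by case: ifP.
by apply/funext => xy /=; rewrite tnth_mktuple; case: ifP.
Qed.

Definition image_measure d1 d2 (T1 : measurableType d1) (T2 : measurableType d2)
    (n : {measure set T1 -> \bar R}) (f : T1 -> T2) (mf : measurable_fun setT f) :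
    {measure set T2 -> \bar R} :=
  measure_function_pushforward__canonical__measure_function_Measure n mf.

Local Open Scope ereal_scope.

(* [m0] is spread on the diagonal; with [m1] and [m2] a uniformly chosen coordinate
   is drawn from [m1] and all the others share one value drawn from [m2]. *)
Lemma star_coupling (mu : probability R R) (m0 m1 m2 : {finite_measure set R -> \bar R}) :
  (forall A, measurable A -> mu A = m0 A + m1 A + m2 A) ->
  m2 setT = m.+1%:R%:E * m1 setT ->
  exists2 pi, couplings N mu pi & forall B, measurable B ->
    m0 (diag_tuple @^-1` B) = 0 ->
    (forall i : 'I_N, (m1 \x m2) (star_tuple i @^-1` B) = 0) -> pi B = 0.
Proof.
move=> muE m2T.
have f1 A : measurable A -> m1 A \is a fin_num by move=> mA; exact: fin_num_measure.
have f2 A : measurable A -> m2 A \is a fin_num by move=> mA; exact: fin_num_measure.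
have [a aE] : exists a : R, m1 setT = a%:E.
  by exists (fine (m1 setT)); rewrite fineK// f1.
have a0 : (0 <= a)%R by rewrite -lee_fin -aE.
(* With [a] the mass of [m1] and [m.+1 * a] that of [m2], this scaling makes the term [i = j]
   contribute [m1] to coordinate [j], and each of the [m.+1] other terms a share [1 / m.+1] of
   [m2]. *)
have k0 : (0 <= (m.+1%:R * a)^-1)%R by rewrite invr_ge0 mulr_ge0.
pose k := NngNum k0.
pose p i : {measure set (N.-tuple R) -> \bar R} :=
  mscale k (image_measure _ _ _ _ (m1 \x m2) _ (measurable_star_tuple i)).
pose pi0 : {measure set (N.-tuple R) -> \bar R} :=
  measure_add (image_measure _ _ _ _ m0 _ measurable_diag_tuple) (msum p N).
have pi0E B : pi0 B = m0 (diag_tuple @^-1` B) +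
    \sum_(i < N) k%:num%:E * (m1 \x m2) (star_tuple i @^-1` B).
  exact: measure_addE.
have marg (j : 'I_N) A : measurable A ->
    pi0 ((fun v : N.-tuple R => tnth v j) @^-1` A) = mu A.
  move=> mA; rewrite pi0E muE// -addeA; congr (_ + _).
    by congr (m0 _); apply/seteqP; split=> y /=; rewrite tnth_mktuple.
  have m1A : m1 A <= a%:E by rewrite -aE; apply: le_measure; rewrite ?inE.
  have m2A : m2 A <= (m.+1%:R * a)%:E.
    by rewrite EFinM -aE -m2T; apply: le_measure; rewrite ?inE.
  rewrite (eq_bigr (fun i : 'I_N => (k%:num * (if i == j then
      fine (m1 A) * (m.+1%:R * a) else a * fine (m2 A)))%:E)); last first.
    move=> i _; rewrite EFinM; congr (_ * _).
    have [->|ij] := eqVneq i j.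
      rewrite EFinM fineK ?f1// EFinM -aE -m2T -product_measure1E//.
      congr product_measure1; apply/seteqP; split=> -[x y]/=.
        by rewrite tnth_mktuple eqxx.
      by rewrite tnth_mktuple eqxx => -[].
    rewrite EFinM fineK ?f2// -aE -product_measure1E//.
    congr product_measure1; apply/seteqP; split=> -[x y]/=;
      by rewrite tnth_mktuple eq_sym val_eqE (negbTE ij) // => -[].
  rewrite sumEFin (bigD1 j)//= eqxx.
  rewrite (eq_bigr (fun=> k%:num * (a * fine (m2 A)))%R); last first.
    by move=> i /negbTE ->.
  have cardj : #|[pred i : 'I_N | i != j]| = m.+1.
    by have := cardC1 j; rewrite card_ord.
  rewrite sumr_const cardj -(fineK (f1 _ mA)) -(fineK (f2 _ mA)) -EFinD; congr (_%:E).
  rewrite -[X in (_ + X)%R = _]mulr_natl.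
  (* If [a = 0] the scaling is [0], as the inverse of [0], but [m1] and [m2] vanish as well. *)
  have [az|an] := eqVneq a 0%R.
    move: m1A m2A; rewrite az mulr0 -(fineK (f1 _ mA)) -(fineK (f2 _ mA)) !lee_fin => h1 h2.
    have -> : fine (m1 A) = 0%R by apply/eqP; rewrite eq_le h1 fine_ge0.
    have -> : fine (m2 A) = 0%R by apply/eqP; rewrite eq_le h2 fine_ge0.
    by rewrite /= !(mulr0, mul0r, addr0).
  have mn : m.+1%:R != 0%R :> R by rewrite pnatr_eq0.
  have -> : k%:num = ((m.+1%:R * a)^-1)%R by [].
  by move: m.+1%:R mn => c cn; field; rewrite an cn.
have pi0T : pi0 setT = 1.
  by rewrite -(probability_setT mu) -(marg ord0 setT).
pose pi : probability (N.-tuple R) R := HB.pack (Measure.sort pi0)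
  (Measure.class pi0) (Measure_isProbability.Build _ _ _ (Measure.sort pi0) pi0T).
exists pi; first by move=> j A mA; exact: marg.
move=> B mB h0 h1; rewrite [pi B]pi0E h0 add0e big1// => i _.
by rewrite h1 mule0.
Qed.

End star_coupling.

(** * Splitting the marginal at the reserve and at the quantile *)

Section threshold_split.
Variables (R : realType) (m : nat) (mu : probability R R) (p s a : R).
Local Notation N := m.+2.
Hypothesis ps : p <= s.
Local Open Scope ereal_scope.
Hypothesis mu_gt_s : mu [set` `]s, +oo[] <= a%:E.
Hypothesis mu_ge_s : a%:E <= mu [set` `[s, +oo[].
Hypothesis aE : mu [set` `[p, +oo[] = (N%:R * a)%:E.

(** [m0] is the part of [mu] below [p], [m1] the part above [s], [m2] the part on [[p, s[]. The atom
    at [s] is divided so that [m1] has mass exactly [a], which leaves [m.+1 * a] for [m2]. *)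
Lemma threshold_split : exists m0 m1 m2 : {finite_measure set R -> \bar R},
  [/\ forall A, measurable A -> mu A = m0 A + m1 A + m2 A,
      m2 setT = m.+1%:R%:E * m1 setT,
      m0 [set` `[p, +oo[] = 0, m1 [set` `]-oo, s[] = 0 & m2 (~` [set` `[p, s]]) = 0].
Proof.
have ffin A : measurable A -> exists x : R, mu A = x%:E.
  by move=> mA; exists (fine (mu A)); rewrite fineK// fin_num_measure.
have [h hE] : exists x, mu [set` `]s, +oo[] = x%:E by exact: ffin.
have [g gE] : exists x, mu [set` `[s, +oo[] = x%:E by exact: ffin.
have [u uE] : exists x, mu [set s] = x%:E by apply: ffin; exact: measurable_set1.
have [l lE] : exists x, mu [set` `[p, s[] = x%:E by exact: ffin.
have ghu : (g = u + h)%R.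
  apply: EFin_inj; rewrite -gE EFinD -uE -hE -measureU//; first 1 last.
    by apply/seteqP; split=> x //= [->]; rewrite in_itv/= ltxx.
  by rewrite setU1itv// bnd_simp.
have Hgl : (N%:R * a = l + g)%R.
  apply: EFin_inj; rewrite -aE EFinD -lE -gE -measureU//.
    by rewrite -itv_bndbnd_setU// bnd_simp.
  apply/seteqP; split=> x //=; rewrite !in_itv/= andbT => -[/andP[_ xs]].
  by rewrite leNgt xs.
have ha : (0 <= a - h)%R by rewrite subr_ge0 -lee_fin -hE.
have ga : (0 <= g - a)%R by rewrite subr_ge0 -lee_fin -gE.
have mlo : measurable [set` `]-oo, p[] by exact: measurable_itv.
have mmi : measurable [set` `[p, s[] by exact: measurable_itv.
have mhi : measurable [set` `]s, +oo[] by exact: measurable_itv.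
have [m1 m1E] := finite_measure_add _ _ _ (mrestr mu mhi) (mscale (NngNum ha) (\d_s)).
have [m2 m2E] := finite_measure_add _ _ _ (mrestr mu mmi) (mscale (NngNum ga) (\d_s)).
exists (mrestr mu mlo), m1, m2; split.
- move=> A mA; rewrite m1E m2E /= /mrestr /mscale/=.
  have As : mu (A `&` [set s]) = (u * \1_A s)%:E.
    rewrite indicE; have [sA|sA] := boolP (s \in A).
      by rewrite mulr1 -uE; congr (mu _); apply/setIidr => x ->; exact: set_mem.
    rewrite mulr0; rewrite (_ : _ `&` _ = set0) ?measure0//.
    by apply/seteqP; split=> x //= -[xA xs]; move: sA; rewrite -xs mem_set.
  have disj (b1 b2 b3 b4 : itv_bound R) : (b2 <= b3)%O ->
      (A `&` [set` Interval b1 b2]) `&` (A `&` [set` Interval b3 b4]) = set0.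
    move=> b23; apply/seteqP; split=> x //= -[[_ x1] [_ x2]].
    move: x1 x2; rewrite !itv_boundlr => /andP[_ h1] /andP[h2 _].
    by move: (le_trans h1 (le_trans b23 h2)); rewrite bnd_simp ltxx.
  have E1 : mu A = mu (A `&` [set` `]-oo, s[]) + mu (A `&` [set` `[s, +oo[]).
    rewrite -measureU//; [|exact: measurableI|exact: measurableI|exact: disj].
    by rewrite -setIUr -itv_bndbnd_setU// set_itvE setIT.
  have E2 : mu (A `&` [set` `]-oo, s[]) =
      mu (A `&` [set` `]-oo, p[]) + mu (A `&` [set` `[p, s[]).
    rewrite -measureU//; [|exact: measurableI|exact: measurableI|exact: disj].
    by rewrite -setIUr -itv_bndbnd_setU// bnd_simp.
  have E3 : mu (A `&` [set` `[s, +oo[]) = mu (A `&` [set s]) + mu (A `&` [set` `]s, +oo[]).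
    rewrite -measureU//; [|by apply: measurableI|exact: measurableI|].
      by rewrite -setIUr setU1itv// bnd_simp.
    by rewrite -set_itv1; apply: disj; rewrite bnd_simp.
  rewrite E1 E2 E3.
  rewrite As /dirac.
  have [x1 ->] := ffin _ (measurableI _ _ mA mlo); have [x2 ->] := ffin _ (measurableI _ _ mA mmi).
  have [x3 ->] := ffin _ (measurableI _ _ mA mhi).
  rewrite -!EFinM -!EFinD; congr (_%:E); rewrite ghu; ring.
- rewrite m1E m2E /= /mrestr /mscale/= !setTI diracT !mule1 hE lE -!EFinD -EFinM.
  congr (_%:E); move: Hgl; rewrite -(natr1 m.+1) => Hgl; lra.
- rewrite /= /mrestr; rewrite (_ : _ `&` _ = set0) ?measure0//.
  by apply/seteqP; split=> x //=; rewrite !in_itv/= andbT => -[px]; rewrite ltNge px.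
- rewrite m1E /= /mrestr /mscale/= /dirac indicE memNset ?mule0 ?adde0; last first.
    by rewrite /= in_itv/= ltxx.
  rewrite (_ : _ `&` _ = set0) ?measure0//.
  by apply/seteqP; split=> x //=; rewrite !in_itv/= andbT => -[sx]; rewrite ltNge ltW.
- rewrite m2E /= /mrestr /mscale/= /dirac indicE memNset ?mule0 ?adde0; last first.
    by rewrite /= in_itv/= lexx ps.
  rewrite (_ : _ `&` _ = set0) ?measure0//.
  by apply/seteqP; split=> x //=; rewrite !in_itv/= => -[nx /andP[px /ltW xs]]; apply: nx; rewrite px.
Qed.

End threshold_split.

(** * The dual price: equality with revenue on the coupling, domination by [shade] *)

Section dual_price.
Variables (R : realType) (m : nat).
Local Notation N := m.+2.

Definition reserve_revenue (n : nat) (p : R) (v : n.-tuple R) : R :=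
  if p <= bid1 n v then Num.max p (bid2 n v) else 0.

(* On [p <= y <= s] this is the tangent at [s] of [shade N s]. *)
Definition dual_price (n : nat) (p s y : R) : R :=
  if y < p then 0 else if y <= s then (n%:R * y - s) / (n%:R - 1) else s.

Lemma measurable_dual_price p s : measurable_fun setT (dual_price N p s).
Proof.
apply: measurable_fun_ifT => //; first exact: measurable_fun_ltr.
apply: measurable_fun_ifT => //; first exact: measurable_fun_ler.
by apply: measurable_funM => //; apply: measurable_funB => //; exact: measurable_funM.
Qed.

Lemma measurable_reserve_revenue p : measurable_fun setT (@reserve_revenue N p).
Proof.
apply: measurable_fun_ifT => //.
  by apply: measurable_fun_ler => //; exact: measurable_bid1.
by apply: measurable_maxr => //; exact: measurable_bid2.
Qed.

Lemma dual_price_at p s : p <= s -> dual_price N p s s = s.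
Proof.
move=> ps; rewrite /dual_price ltNge ps lexx/= NsubnE -(natr1 m.+1).
have : m.+1%:R != 0 :> R by rewrite pnatr_eq0.
by move: m.+1%:R => c c0; field.
Qed.

Lemma dual_price_ge p s x : p <= s -> s <= x -> dual_price N p s x = s.
Proof.
move=> ps; rewrite le_eqVlt => /predU1P[<-|sx]; first exact: dual_price_at.
by rewrite /dual_price ltNge (le_trans ps (ltW sx))/= leNgt sx.
Qed.

(** Where [N * y < s] the price is negative, but for [y >= 0] it is at least [- s / (N - 1)], hence
    at least [- s]. *)
Lemma normr_dual_price_le p s y : 0 <= p <= s -> `|dual_price N p s y| <= s.
Proof.
move=> /andP[p0 ps]; have s0 := le_trans p0 ps.
rewrite /dual_price; case: (ltP y p) => [_|py]; first by rewrite normr0.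
case: (leP y s) => [ys|_]; last by rewrite ger0_norm.
have y0 := le_trans p0 py.
rewrite NsubnE ler_norml ler_pdivrMr// ler_pdivlMr//.
rewrite -(natr1 m.+1) -(natr1 m); have : 0 <= m%:R :> R by [].
move: m%:R => c c0.
have : c * y <= c * s by rewrite ler_wpM2l.
have : 0 <= c * y by rewrite mulr_ge0.
have : 0 <= c * s by rewrite mulr_ge0.
by move=> *; apply/andP; split; lra.
Qed.

Lemma tnth_diag_tuple y (i : 'I_N) : tnth (diag_tuple R m y) i = y.
Proof. by rewrite tnth_mktuple. Qed.

Lemma tnth_star_tuple (i : 'I_N) x y j :
  tnth (star_tuple R m i (x, y)) j = if j == i then x else y.
Proof. by rewrite tnth_mktuple. Qed.

Lemma reserve_revenue_diag p s y : y < Num.max p 0 ->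
  reserve_revenue N p (diag_tuple R m y) =
    N%:R^-1 * \sum_(i < N) dual_price N (Num.max p 0) s (tnth (diag_tuple R m y) i).
Proof.
move=> yp; rewrite big1 ?mulr0; last first.
  by move=> i _; rewrite tnth_diag_tuple /dual_price yp.
rewrite /reserve_revenue; case: ifP => // pb.
have [p0|p0] := ltP 0 p.
  exfalso; move: pb; apply/negP; rewrite -ltNge.
  apply/bigmax_ltP; split=> // i _; rewrite tnth_diag_tuple.
  by move: yp; rewrite max_l// ltW.
(* For [p <= 0] the bids are negative; the second bid, a maximum with default [0], is then [0], and
   so is the payment. *)
have y0 : y <= 0 by move: yp; rewrite max_r// => /ltW.
suff -> : bid2 N (diag_tuple R m y) = 0 by rewrite max_r.
apply/le_anti; rewrite bid2_ge0 andbT.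
apply: bigmax_le => // i _; apply: bigmax_le => // j _.
by rewrite !tnth_diag_tuple minxx.
Qed.

Lemma bid2_star (i : 'I_N) x y : 0 <= y <= x -> bid2 N (star_tuple R m i (x, y)) = y.
Proof.
move=> /andP[y0 yx]; apply/le_anti/andP; split.
  apply: bigmax_le => // j _; apply: bigmax_le => // k kj.
  rewrite !tnth_star_tuple ge_min; case: (eqVneq j i) => [ji|_]; last by rewrite lexx.
  by rewrite -ji (negbTE kj) lexx orbT.
have [j ji] : exists j, j != i.
  exists (if i == ord0 then ord_max else ord0); case: (eqVneq i ord0) => [->//|i0].
  by rewrite eq_sym.
apply: le_trans (min_le_bid2 _ _ _ i j ji).
by rewrite !tnth_star_tuple eqxx (negbTE ji) le_min yx lexx.
Qed.

(** The revenue is the common value [y]. One bidder is priced at [s] and the other [m.+1] at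
    [(N * y - s) / m.+1], so the prices sum to [N * y]. *)
Lemma reserve_revenue_star p s (i : 'I_N) x y : Num.max p 0 <= y <= s -> s <= x ->
  reserve_revenue N p (star_tuple R m i (x, y)) =
    N%:R^-1 * \sum_(j < N) dual_price N (Num.max p 0) s (tnth (star_tuple R m i (x, y)) j).
Proof.
move=> /andP[py ys] sx; have yx := le_trans ys sx.
have [pley y0] : p <= y /\ 0 <= y by move: py; rewrite ge_max => /andP[].
rewrite /reserve_revenue bid2_star ?y0// (max_r pley) ifT; last first.
  apply: le_trans (tnth_le_bid1 _ _ _ i).
  by rewrite tnth_star_tuple eqxx (le_trans pley).
rewrite (bigD1 i)//= tnth_star_tuple eqxx (dual_price_ge _ _ _ (le_trans py ys) sx).
rewrite (eq_bigr (fun=> (N%:R * y - s) / m.+1%:R)); last first.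
  move=> j /negbTE ji; rewrite tnth_star_tuple ji /dual_price.
  by rewrite ltNge py/= ys NsubnE.
have cardi : #|[pred j : 'I_N | j != i]| = m.+1.
  by have := cardC1 i; rewrite card_ord.
rewrite sumr_const cardi -[X in _ * (s + X)]mulr_natr.
have [cn0 Nn0] : m.+1%:R != 0 :> R /\ N%:R != 0 :> R by rewrite !pnatr_eq0.
by move: (m.+1%:R : R) (N%:R : R) cn0 Nn0 => c n c0 n0; field; rewrite n0 c0.
Qed.

(** On [[p, s]], writing [y = s * w ^+ m.+1] with [w = Gcdf N s y] reduces the claim to [s] times
    [pow_tangent_le]. *)
Lemma dual_price_le_shade p s y : 0 < s -> 0 <= p <= s ->
  dual_price N p s y <= shade R N s y.
Proof.
move=> s0 /andP[p0 ps]; rewrite /dual_price.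
case: (ltP y p) => [_|py]; first exact: shade_ge0.
case: (leP y s) => [ys|sy]; last by rewrite shade_gt.
have /andP[w0 w1] := Gcdf_itv01 R m s y s0.
have yE : y = s * Gcdf N s y ^+ m.+1 by rewrite Gcdf_pow// min_l// max_r// (le_trans p0).
rewrite [X in _ * X - _]yE /shade NsubnE ler_pdivrMr//.
have := pow_tangent_le _ m (Gcdf N s y); rewrite w0 w1 -(ler_pM2l s0) => /(_ isT) T.
by apply: (etrans _ T); congr (_ <= _); ring.
Qed.

(** Here [0 < w < 1]: the tangent inequality is strict because [w < 1], and for [y < p] the shade is
    positive because [w > 0]. *)
Lemma dual_price_lt_shade p s y : 0 <= p <= s -> 0 < y < s ->
  dual_price N p s y < shade R N s y.
Proof.
move=> /andP[p0 ps] /andP[y0 ys]; have s0 := lt_trans y0 ys.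
have /andP[w0 w1] := Gcdf_itv01 R m s y s0.
have yE : y = s * Gcdf N s y ^+ m.+1.
  by rewrite Gcdf_pow// min_l ?max_r// ltW.
have wp : 0 < Gcdf N s y.
  rewrite lt_neqAle w0 andbT eq_sym; apply: contraTneq y0 => w.
  by rewrite yE w expr0n mulr0 ltxx.
have wl : Gcdf N s y < 1.
  rewrite lt_neqAle w1 andbT; apply: contraTneq ys => w.
  by rewrite yE w expr1n mulr1 ltxx.
rewrite /dual_price; case: (ltP y p) => [_|py]; first by rewrite mulr_gt0 ?exprn_gt0.
rewrite ltW// [X in _ * X - _]yE /shade NsubnE ltr_pdivrMr//.
have := pow_tangent_lt _ m (Gcdf N s y); rewrite w0 wl -(ltr_pM2l s0) => /(_ isT) T.
by apply: (etrans _ T); congr (_ < _); ring.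
Qed.

End dual_price.

(** * Upper bound on the guarantee of a deterministic reserve *)

(** Equal integrals would force [g - f], which is nonnegative, to vanish almost everywhere, so [A]
    would be null. *)
Lemma lt_integral_bounded d (T : measurableType d) (R : realType)
    (P : probability T R) (f g : T -> R) (M : R) (A : set T) :
  measurable_fun setT f -> measurable_fun setT g ->
  (forall x, `|f x| <= M) -> (forall x, `|g x| <= M) ->
  (forall x, f x <= g x) -> measurable A -> (0 < P A)%E ->
  (forall x, A x -> f x < g x) ->
  (\int[P]_x (f x)%:E < \int[P]_x (g x)%:E)%E.
Proof.
move=> mf mg fM gM fg mA PA fgA.
have intf := probability_bounded_integrable _ _ _ P _ _ mf fM.
have intg := probability_bounded_integrable _ _ _ P _ _ mg gM.
rewrite lt_neqAle; apply/andP; split; last by apply: le_integral => // x _; rewrite lee_fin.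
apply/negP => /eqP eqfg; move: PA; apply/negP; rewrite -leNgt.
have mgf : measurable_fun setT (fun x => (g x - f x)%:E).
  by apply/measurable_EFinP; exact: measurable_funB.
have : (\int[P]_x `|(g x - f x)%:E| = 0)%E.
  under eq_integral do rewrite gee0_abs ?lee_fin ?subr_ge0// EFinB.
  rewrite integralB// -eqfg subee//.
  exact: (integrable_fin_num measurableT intf).
move=> /(ae_eq_integral_abs P measurableT mgf)[B [mB PB0 AB]].
rewrite -PB0; apply: le_measure; rewrite ?inE// => x Ax; apply: AB => /= h.
have /eqP := h Logic.I; rewrite eqe subr_eq0 => /eqP gfx.
by have := fgA x Ax; rewrite gfx ltxx.
Qed.

Section deterministic_reserve.
Variables (R : realType) (m : nat) (mu : probability R R).
Hypothesis hmu : support01 mu.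
Local Notation N := m.+2.
Local Open Scope ereal_scope.

(** The star coupling built on the split at a quantile [s] makes revenue equal to the average dual
    price almost surely, and the marginal alone fixes the mean of that average. *)
Lemma dirac_guarantee_le_dual (p : R) : exists s : R,
  [/\ (Num.max p 0 <= s <= Num.max (Num.max p 0) 1)%R &
    revenue_guarantee N mu (\d_p) <=
      \int[mu]_y (dual_price R N (Num.max p 0) s y)%:E].
Proof.
(* A negative reserve acts as [0]. The bound [M] lies above the support and above [p0], so the range
   for the quantile is nonempty even when [p0 > 1]. *)
set p0 := Num.max p 0%R; set M := Num.max p0 1%R.
have p00 : (0 <= p0)%R by rewrite le_max lexx orbT.
have muM : mu [set` `]M, +oo[] = 0.
  have := @probability_setC _ _ _ mu [set` `[0%R, 1%R]] (measurable_itv _).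
  case: hmu => -> _; rewrite subee// => mu0.
  apply/eqP; rewrite -measure_le0 -mu0; apply: le_measure; rewrite ?inE//.
    exact: measurableC.
  move=> x /=; rewrite !in_itv/= andbT => Mx; apply/negP; rewrite negb_and -!ltNge.
  by rewrite (le_lt_trans _ Mx) ?orbT// le_max lexx orbT.
pose a := (fine (mu [set` `[p0, +oo[]) / N%:R)%R.
have aE : mu [set` `[p0, +oo[] = (N%:R * a)%:E.
  by rewrite /a mulrC divfK ?pnatr_eq0// fineK// fin_num_measure.
have a0 : (0 <= a)%R by rewrite divr_ge0// fine_ge0.
have aH : a%:E <= mu [set` `[p0, +oo[] by rewrite aE lee_fin ler_peMl// ler1n.
have p0M : (p0 <= M)%R by rewrite le_max lexx.
have [s [psM mus mus']] := upper_quantile R mu p0 M a%:E p0M muM (ltac:(by rewrite lee_fin)) aH.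
exists s; split=> //; case/andP: psM => ps _.
have [m0 [m1 [m2 [muE m2T m0p m1s m2ps]]]] := threshold_split R m mu p0 s a ps mus mus' aE.
have [pi cpi pi0] := star_coupling R m mu m0 m1 m2 muE m2T.
have dM x : (`|dual_price R N p0 s x| <= s)%R by apply: normr_dual_price_le; rewrite p00.
have md := measurable_dual_price R m p0 s.
rewrite -(coupling_integral R N mu pi _ s isT cpi md dM).
have mr := measurable_reserve_revenue R m p.
have ms : measurable_fun setT (fun v : N.-tuple R =>
    (N%:R^-1 * \sum_(i < N) dual_price R N p0 s (tnth v i))%R).
  apply: measurable_funM => //; apply: measurable_sum => i.
  by apply: measurableT_comp => //; exact: measurable_tnth.
apply: (@le_trans _ _ (\int[pi]_v (reserve_revenue R N p v)%:E)).
  apply: ereal_inf_lbound; exists pi => //.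
  by apply: eq_integral => v _; rewrite spa_revenue_dirac.
rewrite le_eqVlt; apply/orP; left; apply/eqP.
(* The event where revenue and average price differ; it is shown to be null for each component of
   the coupling. *)
pose B := [set v : N.-tuple R | reserve_revenue R N p v !=
  (N%:R^-1 * \sum_(i < N) dual_price R N p0 s (tnth v i))%R].
have mB : measurable B.
  have := measurable_fun_eqr mr ms => /(_ measurableT [set false] I).
  rewrite setTI; congr measurable; apply/seteqP; split=> v /=.
    by move/negbT.
  by move/negbTE.
apply: ae_eq_integral => //; [exact/measurable_EFinP|exact/measurable_EFinP|].
exists B; split=> //; last first.
  by move=> v /= nv; apply/negP => /eqP e; apply: nv => _; rewrite e.
have mitv (i : interval R) : measurable [set` i] by exact: measurable_itv.
apply: pi0 => // [|i].
  apply/eqP; rewrite -measure_le0 -m0p; apply: le_measure; rewrite ?inE//.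
    by rewrite -[X in measurable X]setTI; exact: measurable_diag_tuple.
  move=> y /=; rewrite in_itv/= andbT leNgt; apply: contra => yp.
  by rewrite -(reserve_revenue_diag R m p s y yp).
have mx : measurable ([set` `]-oo, s[] `*` setT : set (R * R)) by exact: measurableX.
have my : measurable (setT `*` ~` [set` `[p0, s]] : set (R * R)).
  by apply: measurableX => //; exact: measurableC.
have px : (m1 \x m2) ([set` `]-oo, s[] `*` setT) = 0.
  rewrite product_measure1E//.
  by apply: etrans (congr1 (fun z => z * _) m1s) _; rewrite mul0e.
have py : (m1 \x m2) (setT `*` ~` [set` `[p0, s]]) = 0.
  rewrite product_measure1E//; last exact: measurableC.
  by apply: etrans (congr1 (fun z => _ * z) m2ps) _; rewrite mule0.
apply/eqP; rewrite -measure_le0.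
(* A star profile can lie in [B] only if its centre is below [s] or its common value is outside
   [[p0, s]]. *)
apply: (@le_trans _ _ ((m1 \x m2) ([set` `]-oo, s[] `*` setT `|` setT `*` ~` [set` `[p0, s]]))).
  apply: le_measure; rewrite ?inE//; [|exact: measurableU|].
    by rewrite -[X in measurable X]setTI; exact: measurable_star_tuple.
  move=> [x y] /= Bxy; rewrite in_itv/=; have [sx|xs] := leP s x; last by left.
  right; split=> //; rewrite in_itv/= => pys.
  by move/eqP: Bxy; apply; exact: (reserve_revenue_star R m p s i x y pys sx).
by rewrite measureU0// measure_le0; apply/eqP.
Qed.

Lemma support_itv_gt0 (x e : R) : (0 <= x <= 1)%R -> (0 < e)%R ->
  0 < mu [set` `](x - e)%R, (x + e)%R[].
Proof. by move=> x01 e0; apply: hmu.2. Qed.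

(** Positivity of one value of [L] settles the degenerate reserves, whose guarantee is at most
    [0]. *)
Lemma Lrevenue1_gt0 : 0 < Lrevenue N mu 1.
Proof.
rewrite LrevenueE//.
have -> : 0 = \int[mu]_y (0%R : R)%:E by rewrite integral0.
apply: (lt_integral_bounded _ _ _ mu (cst 0%R) (shade R N 1) 1
  [set` `](2^-1 - 2^-1)%R, (2^-1 + 2^-1)%R[]) => //.
- exact: measurable_shade.
- by move=> x /=; rewrite normr0.
- by move=> x; exact: normr_shade_le.
- by move=> x /=; exact: shade_ge0.
- by apply: support_itv_gt0; lra.
- move=> x /=; rewrite in_itv/= => /andP[x0 x1].
  (* With reserve and threshold both [1] the dual price is [0] at [x < 1], so the strict bound gives
     a positive shade. *)
  apply: le_lt_trans (dual_price_lt_shade R m 1%R 1%R x _ _); last 2 first.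
  + by rewrite ler01 lexx.
  + by apply/andP; split; lra.
  by rewrite /dual_price ifT//; lra.
Qed.

Lemma dirac_guarantee_lt (p : R) : exists2 s : R, (0 < s <= 1)%R &
  revenue_guarantee N mu (\d_p) < Lrevenue N mu s.
Proof.
have [s [/andP[ps sM] le_dual]] := dirac_guarantee_le_dual p.
move: ps sM le_dual; set p0 := Num.max p 0%R => ps sM le_dual.
have p00 : (0 <= p0)%R by rewrite le_max lexx orbT.
have s0 := le_trans p00 ps.
(* A reserve above the support has a dual price that vanishes almost surely. *)
have [p1|p1] := ltP 1%R p0.
  exists 1%R; first by rewrite ltr01 lexx.
  apply: le_lt_trans Lrevenue1_gt0; apply: le_trans le_dual _.
  rewrite (@ae_eq_integral _ _ _ mu setT (cst 0))//=; first by rewrite integral0.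
    by apply/measurable_EFinP; exact: measurable_dual_price.
  exists [set` `[p0, +oo[]; split=> //.
    have := @probability_setC _ _ _ mu [set` `[0%R, 1%R]] (measurable_itv _).
    case: hmu => -> _; rewrite subee// => mu0.
    apply/eqP; rewrite -measure_le0 -mu0; apply: le_measure; rewrite ?inE//.
      exact: measurableC.
    move=> x /=; rewrite !in_itv/= andbT => px; apply/negP; rewrite negb_and -!ltNge.
    by rewrite (lt_le_trans p1 px) orbT.
  move=> y /= ny; rewrite in_itv/= andbT leNgt; apply/negP => yp.
  by apply: ny => _; rewrite /dual_price yp.
have s1 : (s <= 1)%R by move: sM; rewrite max_r.
(* The quantile can be [0] when [0] carries a large atom; then [p0 = 0] and the dual price is
   identically [0]. *)
move: s0; rewrite le_eqVlt => /predU1P[s0|s0].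
  exists 1%R; first by rewrite ltr01 lexx.
  apply: le_lt_trans Lrevenue1_gt0; apply: le_trans le_dual _.
  rewrite integral0_eq// => y _; congr (_%:E).
  have p0E : p0 = 0%R by apply/le_anti; rewrite p00 andbT s0.
  rewrite /dual_price p0E -s0; case: ltP => // y0; case: leP => // y0'.
  by rewrite (_ : y = 0%R) ?mulr0 ?subrr ?mul0r//; apply/le_anti; rewrite y0 y0'.
(* In the main case the inequality is strict on []0, s[], the ball of radius [s / 2] about [s / 2],
   which has positive mass by full support. *)
exists s; first by rewrite s0.
apply: le_lt_trans le_dual _; rewrite LrevenueE//.
apply: (lt_integral_bounded _ _ _ mu _ _ s
  [set` `](s / 2 - s / 2)%R, (s / 2 + s / 2)%R[]) => //.
- exact: measurable_dual_price.
- exact: measurable_shade.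
- by move=> x; apply: normr_dual_price_le; rewrite p00.
- by move=> x; exact: normr_shade_le.
- by move=> x; apply: dual_price_le_shade => //; rewrite p00.
- by apply: support_itv_gt0; lra.
- move=> x /=; rewrite in_itv/= => /andP[x0 x1].
  apply: dual_price_lt_shade; first by rewrite p00.
  by apply/andP; split; lra.
Qed.

End deterministic_reserve.

(** * Comparison of the two guarantees through [L] *)

Theorem theorem4 (R : realType) (N : nat) (hN : (2 <= N)%N)
  (mu : probability R R) (hmu : support01 mu)
  (rstar : R) (hrstar : 0 < rstar <= 1)
  (hmax : forall r : R, 0 < r <= 1 -> (Lrevenue N mu r <= Lrevenue N mu rstar)%E)
  (G : probability R R)
  (hG : forall x : R, G [set` `]-oo, x]] = (Gcdf N rstar x)%:E)
  (rd : R)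
  (hrd : forall r : R, (revenue_guarantee N mu (\d_r) <=
                        revenue_guarantee N mu (\d_rd))%E) :
  (revenue_guarantee N mu (\d_rd) < revenue_guarantee N mu G)%E.
Proof.
case: N hN hmax hG hrd => [|[|m]]// _ hmax hG _.
have [s s01 lt_s] := dirac_guarantee_lt R m mu hmu rd.
have /andP[r0 _] := hrstar.
apply: (lt_le_trans lt_s); apply: (le_trans (hmax s s01)).
exact: revenue_guarantee_ge.
Qed.
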